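(* Let $G$ be a finite directed graph, $\mathcal H$ its monoid of hikes, $\mu$ the Möbius function on $\mathcal H$, and let $f:\mathcal H\to\mathbb R$ be totally additive, i.e. $f(h.h')=f(h)+f(h')$ for all $h,h'\in\mathcal H$. Then for every $h\in\mathcal H$, $$f*\mu(h)=\begin{cases} f(c) & \text{if } h \text{ is a non-trivial walk, with } c \text{ its unique prime right-divisor},\\ 0&\text{otherwise.}\end{cases}$$
   Context: Let $G=(V,E)$ be a finite directed graph with $V=\{v_1,\dots,v_N\}$ and $E\subseteq V^2$ (loops allowed). Each arc $(v_i,v_j)\in E$ is identified with a letter $w_{ij}$. Let $\mathcal M$ be the trace monoid generated by the arcs, i.e. the quotient of the free monoid on the arcs by the relations $w_{ij}w_{kl}=w_{kl}w_{ij}$ for $i\neq k$. The words on the arcs in the equivalence class of an element of $\mathcal M$ are called its representations. A hike is an element $h=w_{i_1j_1}\cdots w_{i_\ell j_\ell}$ of $\mathcal M$ such that for each $i$, $\#\{k: i_k=i\}=\#\{k: j_k=i\}$. The hikes form a submonoid $\mathcal H$ of $\mathcal M$, containing the empty (trivial) hike $1$. A hike is a (closed) walk if it has a contiguous representation, i.e. one in which each arc but the first starts at the vertex where the previous arc ended; it is non-trivial if it is not $1$. A simple cycle (also called a prime) is a hike of the form $w_{i_1i_2}w_{i_2i_3}\cdots w_{i_\ell i_1}$ with $\ell\ge1$ and $i_1,\dots,i_\ell$ pairwise distinct. A prime right-divisor of $h$ is a prime $c$ with $h=h'.c$ for some $h'\in\mathcal H$; a non-trivial hike is a walk if and only if it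 has a unique prime right-divisor. For $d,h\in\mathcal H$, $d\mid h$ means $h=d.h'$ for some (necessarily unique) $h'\in\mathcal H$, denoted $h/d$. The Dirichlet convolution of $f,g:\mathcal H\to\mathbb R$ is $f*g(h)=\sum_{d\mid h}f(d)g(h/d)$; its identity is $\delta$, with $\delta(1)=1$ and $\delta(h)=0$ for $h\ne1$. The Möbius function $\mu$ is the inverse of the constant function $1$ for $*$; explicitly, $\mu(1)=1$, $\mu(h)=(-1)^k$ if $h$ is a product of $k$ pairwise vertex-disjoint simple cycles, and $\mu(h)=0$ otherwise. *)

(* Defs.v *)
From HB Require Import structures.
From mathcomp Require Import all_boot all_order all_algebra.
From mathcomp Require Import all_classical all_reals.

Set Implicit Arguments.
Unset Strict Implicit.
Unset Printing Implicit Defensive.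

Import GRing.Theory.
Local Open Scope quotient_scope.
Local Open Scope group_scope.

(* A digraph on the finite type V is its set of arcs E : {set V * V}.         *)
Definition arc (V : finType) (E : {set V * V}) := {a : V * V | a \in E}.

Section Trace.
Variables (V : finType) (E : {set V * V}).

Definition src (a : arc E) : V := (val a).1.
Definition tgt (a : arc E) : V := (val a).2.

(* The smallest congruence on words identifying ab and ba whenever the arcs   *)
(* a and b start at different vertices.                                       *)
Inductive trace_congr : seq (arc E) -> seq (arc E) -> Prop :=
| trace_congr_comm a b : src a != src b -> trace_congr [:: a; b] [:: b; a]
| trace_congr_refl u : trace_congr u u
| trace_congr_sym u v : trace_congr u v -> trace_congr v u
| trace_congr_trans u v w :
    trace_congr u v -> trace_congr v w -> trace_congr u w
| trace_congr_cat u u' v v' :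
    trace_congr u u' -> trace_congr v v' -> trace_congr (u ++ v) (u' ++ v').

Definition trace_rel : rel (seq (arc E)) := fun u v => `[< trace_congr u v >].

Lemma trace_rel_refl : reflexive trace_rel.
Proof. by move=> u; apply/asboolP; exact: trace_congr_refl. Qed.

Lemma trace_rel_sym : symmetric trace_rel.
Proof.
by move=> u v; apply/asboolP/asboolP; exact: trace_congr_sym.
Qed.

Lemma trace_rel_trans : transitive trace_rel.
Proof.
move=> v u w /asboolP uv /asboolP vw; apply/asboolP.
exact: trace_congr_trans uv vw.
Qed.

Definition trace_equiv :=
  EquivRel trace_rel trace_rel_refl trace_rel_sym trace_rel_trans.

Definition trace := {eq_quot trace_equiv}.

HB.instance Definition _ := Choice.on trace.
HB.instance Definition _ := EqQuotient.on trace.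

(* The element of the trace monoid represented by the word u.                 *)
Definition trace_of (u : seq (arc E)) : trace := \pi_trace u.

Lemma trace_ofP u v : trace_of u = trace_of v <-> trace_congr u v.
Proof.
by rewrite /trace_of; split=> [/eqmodP /asboolP|uv]; [|apply/eqmodP/asboolP].
Qed.

Lemma trace_ofK (x : trace) : trace_of (repr x) = x.
Proof. exact: reprK. Qed.

Definition trace_mul (x y : trace) : trace := trace_of (repr x ++ repr y).

Lemma trace_of_cat u v : trace_mul (trace_of u) (trace_of v) = trace_of (u ++ v).
Proof.
by apply/trace_ofP; apply: trace_congr_cat; apply/trace_ofP; rewrite trace_ofK.
Qed.

Lemma trace_mulA : associative trace_mul.
Proof.
move=> x y z; rewrite -[x]trace_ofK -[y]trace_ofK -[z]trace_ofK.
by rewrite !trace_of_cat catA.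
Qed.

Lemma trace_mul1 : left_id (trace_of [::]) trace_mul.
Proof. by move=> x; rewrite -[x]trace_ofK trace_of_cat. Qed.

Lemma trace_1mul : right_id (trace_of [::]) trace_mul.
Proof. by move=> x; rewrite -[x]trace_ofK trace_of_cat cats0. Qed.

HB.instance Definition _ :=
  isMonoid.Build trace trace_mulA trace_mul1 trace_1mul.

Lemma trace_of1 : trace_of [::] = 1.
Proof. by []. Qed.

Lemma trace_ofM u v : trace_of (u ++ v) = trace_of u * trace_of v.
Proof. by rewrite -trace_of_cat. Qed.

Lemma trace_congr_perm u v : trace_congr u v -> perm_eq u v.
Proof.
elim=> {u v} [a b _|u|u v _|u v w _ uv _ vw|u u' v v' _ + _ +].
- by rewrite (perm_catC [:: a] [:: b]).
- exact: perm_refl.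
- by rewrite perm_sym.
- exact: perm_trans uv vw.
- exact: perm_cat.
Qed.

Definition balanced_word (w : seq (arc E)) : bool :=
  [forall i, count (fun a => src a == i) w == count (fun a => tgt a == i) w].

Definition balanced (x : trace) : bool := balanced_word (repr x).

(* Being balanced does not depend on the representation.                      *)
Lemma balanced_of w : balanced (trace_of w) = balanced_word w.
Proof.
have /permP wr : perm_eq (repr (trace_of w)) w.
  by apply/trace_congr_perm/trace_ofP/trace_ofK.
by apply: eq_forallb => i; rewrite !wr.
Qed.

Lemma balanced_monoid_closed : monoid_closed balanced.
Proof.
split=> [|x y].
  by change (is_true (balanced 1)); rewrite -trace_of1 balanced_of; apply/forallP.
change (balanced x -> balanced y -> balanced (x * y)).
rewrite -[x]trace_ofK -[y]trace_ofK -trace_ofM !balanced_of.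
move=> /forallP xb /forallP yb; apply/forallP => i.
by rewrite !count_cat (eqP (xb i)) (eqP (yb i)).
Qed.

Definition hike := {x : trace | balanced x}.

HB.instance Definition _ := Choice.on hike.
HB.instance Definition _ := SubType.on hike.
HB.instance Definition _ := SubChoice_isSubMonoid.Build trace balanced hike
  balanced_monoid_closed.

(* Consecutive arcs are head to tail; for hikes, which are balanced, such a   *)
(* contiguous representation is automatically closed.                         *)
Definition consecutive (a b : arc E) : bool := tgt a == src b.

Definition represents (w : seq (arc E)) (h : hike) : Prop :=
  trace_of w = val h.

Definition is_walk (h : hike) : Prop :=
  exists2 w, represents w h & sorted consecutive w.

Definition is_prime (c : hike) : Prop :=
  exists2 w, represents w c &
    [/\ w != [::], cycle consecutive w & uniq (map src w)].

Definition prime_right_divisor (h c : hike) : Prop :=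
  is_prime c /\ exists h' : hike, h = h' * c.

Definition hdvd (d h : hike) : Prop := exists h' : hike, h = d * h'.

(* h / d; the value is 1 when d does not divide h.                            *)
Definition hdiv (h d : hike) : hike := xget 1 [set h' | h = d * h']%classic.

(* Two words are congruent iff, for each vertex, they list the arcs leaving   *)
(* it in the same order.                                                      *)
Lemma trace_congrP u v : trace_congr u v <->
  forall i, [seq a <- u | src a == i] = [seq a <- v | src a == i].
Proof.
split.
  move=> uv i; elim: uv => {u v} [a b ab|//|//|u v w _ -> _ -> //|].
    move: ab => /=; case: (eqVneq (src a) i) => [->|//].
    by case: (eqVneq (src b) i) => // ->; rewrite eqxx.
  by move=> u u' v v' _ uE _ vE; rewrite !filter_cat uE vE.
have swap a p : src a \notin map src p -> trace_congr (p ++ [:: a]) (a :: p).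
  elim: p => [_|b p IH] /=; first exact: trace_congr_refl.
  rewrite inE negb_or => /andP[ab /IH {}IH].
  apply: (@trace_congr_trans _ (b :: a :: p)).
    exact: (@trace_congr_cat [:: b] [:: b]) (trace_congr_refl _) IH.
  apply: (@trace_congr_cat [:: b; a] [:: a; b]); last exact: trace_congr_refl.
  by apply: trace_congr_comm; rewrite eq_sym.
elim: u v => [|a u IH] v uv.
  case: v uv => [|b v] uv; first exact: trace_congr_refl.
  by have /= := uv (src b); rewrite eqxx.
have hasv : has (fun b => src b == src a) v.
  by rewrite has_filter -uv /= eqxx.
case: (split_find hasv) uv => b p s /eqP ba pNa uv.
have pF : [seq c <- p | src c == src a] = [::].
  by apply/eqP; rewrite -[_ == _]negbK -has_filter.
have /= := uv (src a); rewrite eqxx -cats1 !filter_cat pF /= ba eqxx /=.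
case=> ab _; subst b.
have aNp : src a \notin map src p.
  by apply: contra pNa => /mapP[c cp ->]; apply/hasP; exists c.
apply: (@trace_congr_trans _ (a :: (p ++ s))); last first.
  rewrite -cat_cons; apply: trace_congr_cat; last exact: trace_congr_refl.
  exact/trace_congr_sym/swap.
apply: (@trace_congr_cat [:: a] [:: a]); first exact: trace_congr_refl.
apply: IH => i; have := uv i; rewrite -cats1 -catA !filter_cat /=.
case: (eqVneq (src a) i) => [<-|//]; rewrite pF /= => -[].
by [].
Qed.

Lemma trace_mulgI (x : trace) : injective (fun y : trace => x * y).
Proof.
move=> y z; rewrite -[x]trace_ofK -[y]trace_ofK -[z]trace_ofK -!trace_ofM.
move=> /trace_ofP/trace_congrP xyz; apply/trace_ofP/trace_congrP => i.
by have /eqP := xyz i; rewrite !filter_cat eqseq_cat// eqxx => /eqP.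
Qed.

Lemma hdivE (d h h' : hike) : h = d * h' -> hdiv h d = h'.
Proof.
move=> hE; rewrite /hdiv; case: xgetP => [k _ /= hk|/(_ h')//].
apply/val_inj/(@trace_mulgI (val d)); transitivity (val h).
  by rewrite hk.
by rewrite hE.
Qed.

Lemma finite_hdvd (h : hike) : finite_set [set d | hdvd d h]%classic.
Proof.
pose n := size (repr (val h)).
pose F (t : {k : 'I_n.+1 & k.-tuple (arc E)}) : hike :=
  insubd (1 : hike) (trace_of (tagged t)).
apply: (@sub_finite_set _ _ (F @` setT)%classic); last first.
  exact/finite_image/finite_finset.
move=> d /= [h' hE].
have : val h = val d * val h' by rewrite hE.
rewrite -[val h]trace_ofK -[val d]trace_ofK -[val h']trace_ofK -trace_ofM.
move=> /trace_ofP/trace_congr_perm/perm_size; rewrite size_cat => szE.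
have szd : (size (repr (val d)) < n.+1)%N by rewrite /n szE ltnS leq_addr.
exists (existT (fun k : 'I_n.+1 => k.-tuple (arc E)) (Ordinal szd)
  (in_tuple (repr (val d)))) => //.
by rewrite /F /= trace_ofK valKd.
Qed.

End Trace.

Section Convolution.
Variables (V : finType) (E : {set V * V}) (R : realType).
Local Open Scope classical_set_scope.

(* The sum is finite by finite_hdvd.                                          *)
Definition dconv (f g : hike E -> R) : hike E -> R :=
  fun h => (\sum_(d \in [set d | hdvd d h]) f d * g (hdiv h d))%R.

Definition ddelta : hike E -> R := fun h => ((h == 1%g)%:R)%R.

(* The two-sided inverse of the constant function 1 for dconv.                *)
Definition mobius : hike E -> R :=
  xget ddelta [set m | dconv m (fun=> 1%R) = ddelta /\
                       dconv (fun=> 1%R) m = ddelta].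

Definition totally_additive (f : hike E -> R) : Prop :=
  forall h h' : hike E, f (h * h')%g = (f h + f h')%R.

End Convolution.

(* Main.v *)
(* For a hike h let phi send each vertex of its support to the target of the  *)
(* last arc of h leaving it.  The products of vertex-disjoint simple cycles   *)
(* that right-divide h correspond to the sets A with phi(A) = A, and such an  *)
(* A is a disjoint union of phi-cycles, the prime right-divisors of h.        *)
(* Hence, for F on hikes,                                                     *)
(*   F * mu (h) = sum over A of (-1)^(number of cycles in A) F(h / s_A),      *)
(* where s_A is the right-divisor attached to A.  Fixing a cycle C and pairing*)
(* A with A + C, the terms of an additive F collapse to                       *)
(*   F(C) * (sum of the signs of the A disjoint from C),                      *)
(* and the last sum is 1 if C is the only cycle and, pairing again with a     *)
(* second cycle, 0 otherwise.  Finally h is a walk iff phi has one cycle: the *)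
(* vertex of the last exit of a contiguous word lies on every cycle, and      *)
(* conversely a walk that greedily follows unused arcs from a vertex of the   *)
(* only cycle exhausts h, as a leftover would contain another cycle.          *)

From HB Require Import structures.
From mathcomp Require Import all_boot all_order all_algebra zify.
Require Import Defs.

Set Implicit Arguments.
Unset Strict Implicit.
Unset Printing Implicit Defensive.

Import GRing.Theory.

(** * Cycles of a self-map of a finite set *)

(** The sum over divisors becomes a sum over sets of vertices. A trace is determined by its lists
    [arcs_from x i]; a right-divisor with at most one arc per vertex consists of last arcs, and its
    balance says that [next (val h)] permutes its support ([squarefree_right_divisor],
    [final_balanced]). Since mu vanishes on the other hikes, [dconv_cycle_mobius] gives f * mu (h)
    as a signed sum over invariant sets. Toggling one cycle C evaluates it ([sum_invariant_atom]),
    and a second cycle makes it vanish ([sum_invariant_disjoint]). The same sum for the constant 1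
    is delta, which with [dconv1_inj] identifies mu ([cycle_mobiusE]). The prime right-divisors are
    the s_C ([prime_right_divisor_atom], [atom_prime_right_divisor]), and the non-trivial walks are
    the hikes with exactly one cycle ([walk_unique_atom], [unique_atom_walk]). *)

Section FunctionalGraph.
Variables (V : finType) (phi : V -> V) (S : {set V}).
Implicit Types A B C D : {set V}.
Local Open Scope set_scope.

Definition stable C : bool :=
  [&& C != set0, C \subset S & phi @: C \subset C].

(** The cycles of [phi] inside [S], encoded by minimality so that no base point has to be chosen. *)
Definition atom C : bool := minset stable C.

Definition invariant_set A : bool := (A \subset S) && (phi @: A == A).

Lemma atom_stable C : atom C -> stable C.
Proof. exact: minsetp. Qed.

Lemma atom_neq0 C : atom C -> C != set0.
Proof. by move=> /atom_stable /and3P[]. Qed.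

Lemma atom_invariant C : atom C -> invariant_set C.
Proof.
move=> Cat; have /and3P[C0 CS fC] := atom_stable Cat.
rewrite /invariant_set CS; apply/eqP/(minsetinf Cat) => //.
by rewrite /stable imset_eq0 C0 (subset_trans fC CS) imsetS.
Qed.

Lemma exists_atom A : stable A -> exists2 C, atom C & C \subset A.
Proof. by move=> /minset_exists[C]; exists C. Qed.

Lemma invariant_set0 : invariant_set set0.
Proof. by rewrite /invariant_set sub0set imset0 eqxx. Qed.

Lemma invariant_stable A : invariant_set A -> A != set0 -> stable A.
Proof. by move=> /andP[AS /eqP fA] A0; rewrite /stable A0 AS fA subxx. Qed.

Lemma invariantU A B :
  invariant_set A -> invariant_set B -> invariant_set (A :|: B).
Proof.
move=> /andP[AS /eqP fA] /andP[BS /eqP fB].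
by rewrite /invariant_set subUset AS BS imsetU fA fB eqxx.
Qed.

Lemma invariant_inj A : invariant_set A -> {in A &, injective phi}.
Proof. by move=> /andP[_ /eqP fA]; apply/imset_injP; rewrite fA. Qed.

(* phi is injective on the union of two invariant sets, so it also preserves  *)
(* their difference.                                                          *)
Lemma invariantD A B :
  invariant_set A -> invariant_set B -> invariant_set (A :\: B).
Proof.
move=> Ai Bi; have injAB := invariant_inj (invariantU Ai Bi).
have /andP[AS /eqP fA] := Ai; have /andP[BS /eqP fB] := Bi.
have DA : A :\: B \subset A by exact: subsetDl.
rewrite /invariant_set (subset_trans DA AS)/= eqEcard; apply/andP; split.
  apply/subsetP => _ /imsetP[x /setDP[xA xB] ->].
  rewrite inE -fA imset_f// andbT; apply/negP => fxB.
  move: fxB; rewrite -fB => /imsetP[y yB fxy].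
  by move: xB; rewrite (injAB x y) ?yB// inE ?xA ?yB ?orbT.
rewrite card_in_imset// => x y /setDP[xA _] /setDP[yA _].
exact: (invariant_inj Ai) xA yA.
Qed.

(** If nonempty, [C :&: A] is stable, so it is all of [C] by minimality. *)
Lemma atom_disjointVsub A C :
  invariant_set A -> atom C -> [disjoint A & C] || (C \subset A).
Proof.
move=> /andP[AS /eqP fA] Cat; rewrite -setI_eq0 setIC.
have [//|CA] := eqVneq (C :&: A) set0.
apply/setIidPl/(minsetinf Cat); last exact: subsetIl.
have /and3P[_ CS fC] := atom_stable Cat.
rewrite /stable CA (subset_trans (subsetIr _ _) AS)/= subsetI.
rewrite (subset_trans (imsetS _ (subsetIl _ _)) fC)/=.
by rewrite -{2}fA imsetS// subsetIr.
Qed.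

Lemma atom_disjoint C D : atom C -> atom D -> C != D -> [disjoint C & D].
Proof.
move=> Cat Dat CD.
have /orP[//|DC] := atom_disjointVsub (atom_invariant Cat) Dat.
by case/eqP: CD; rewrite (minsetinf Cat (atom_stable Dat) DC).
Qed.

Lemma invariantU_atom A C :
  atom C -> [disjoint A & C] -> invariant_set (A :|: C) = invariant_set A.
Proof.
move=> Cat AC; have Ci := atom_invariant Cat; apply/idP/idP => Ai.
  have -> : A = (A :|: C) :\: C by rewrite setDUl setDv setU0 (setDidPl AC).
  exact: invariantD.
exact: invariantU.
Qed.

Definition atoms_in A : {set {set V}} := [set C | atom C & C \subset A].

Lemma atoms_in0 : atoms_in set0 = set0.
Proof.
apply/setP => C; rewrite !inE subset0; apply/negP => /andP[/atom_neq0 C0].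
exact/negP.
Qed.

(** An atom of the union other than [C] is disjoint from [C], hence already lies in [A]. *)
Lemma card_atoms_inU A C : invariant_set A -> atom C -> [disjoint A & C] ->
  #|atoms_in (A :|: C)| = #|atoms_in A|.+1.
Proof.
move=> Ai Cat AC; have CNA : C \notin atoms_in A.
  rewrite inE Cat/=; apply: contra (atom_neq0 Cat) => CA.
  by rewrite -(setIidPr CA) setI_eq0.
rewrite -add1n -[1%N]/(true : nat) -CNA -cardsU1; congr #|pred_of_set _|.
apply/setP => D; rewrite !inE; have [->|DC] := eqVneq D C.
  by rewrite Cat subsetUr.
case Dat: (atom D) => //=; apply/idP/idP => [DAC|/subset_trans-> //].
  apply/subsetP => x xD; have /setUP[//|xC] := subsetP DAC x xD.
  by rewrite (disjointFr (atom_disjoint Dat Cat DC) xD) in xC.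
exact: subsetUl.
Qed.

Lemma invariant_disjoint_atom C A :
    (forall D, atom D -> D = C) -> atom C ->
  (invariant_set A && [disjoint A & C]) = (A == set0).
Proof.
move=> uC Cat; apply/andP/eqP => [[Ai AC]|->]; last first.
  by rewrite invariant_set0 -setI_eq0 set0I.
apply/eqP/negPn/negP => A0.
have [D Dat DA] := exists_atom (invariant_stable Ai A0).
move: DA; rewrite (uC D Dat) => CA; have := atom_neq0 Cat.
by rewrite -(setIidPr CA) setI_eq0 AC.
Qed.

(** * Signed sums over invariant sets *)

Section SignedSums.
Variable R : comNzRingType.
Local Open Scope ring_scope.

(** Pairs each index disjoint from [C] with its union with [C]; removing [C] is the inverse. *)
Lemma sum_flip (P : pred {set V}) C (G : {set V} -> R) :
    C != set0 ->
    (forall A, P A -> [disjoint A & C] || (C \subset A)) ->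
    (forall A, [disjoint A & C] -> P (A :|: C) = P A) ->
  \sum_(A | P A) G A =
  \sum_(A | P A && [disjoint A & C]) (G A + G (A :|: C)).
Proof.
move=> C0 PC PU; rewrite (bigID (fun A => [disjoint A & C])) big_split/=.
congr (_ + _); rewrite (reindex_onto (fun A => A :|: C) (fun A => A :\: C))/=.
  apply: eq_bigl => A; have [AC|nAC] := boolP [disjoint A & C].
    rewrite PU// setDUl setDv setU0 (setDidPl AC) eqxx !andbT andb_idr// => _.
    by rewrite -setI_eq0 setIUl setIid setU_eq0 (negbTE C0) andbF.
  rewrite andbF; apply/negbTE; apply: contraNN nAC => /andP[_ /eqP <-].
  by rewrite -setI_eq0 setDUl setDv setU0 setIDAC -setIDA setDv setI0.
move=> A /andP[PA nAC]; have := PC A PA; rewrite (negbTE nAC)/= => CA.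
by rewrite -[RHS](setID A C) setUC (setIidPr CA).
Qed.

Definition atom_sign A : R := (-1) ^+ #|atoms_in A|.

Lemma atom_sign0 : atom_sign set0 = 1.
Proof. by rewrite /atom_sign atoms_in0 cards0. Qed.

(** Adding [C] flips the sign, so each pair contributes the sign of [A] times the constant
    difference [k]. *)
Lemma sum_invariant_atom C (F : {set V} -> R) k : atom C ->
    (forall A, invariant_set A -> [disjoint A & C] -> F A - F (A :|: C) = k) ->
  \sum_(A | invariant_set A) atom_sign A * F A =
  k * \sum_(A | invariant_set A && [disjoint A & C]) atom_sign A.
Proof.
move=> Cat Fk; rewrite (@sum_flip invariant_set C) ?atom_neq0//.
- rewrite mulr_sumr; apply: eq_bigr => A /andP[Ai AC].
  by rewrite /atom_sign card_atoms_inU// exprS mulN1r mulNr -mulrBr Fk// mulrC.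
- by move=> A Ai; apply: atom_disjointVsub.
- by move=> A; apply: invariantU_atom.
Qed.

(** Toggling [D] preserves disjointness from [C] and flips the sign, so the terms cancel in
    pairs. *)
Lemma sum_invariant_disjoint C D : atom C -> atom D -> C != D ->
  \sum_(A | invariant_set A && [disjoint A & C]) atom_sign A = 0.
Proof.
move=> Cat Dat CD.
have DC : [disjoint D & C] by rewrite disjoint_sym atom_disjoint.
rewrite (@sum_flip _ D) ?atom_neq0//.
- rewrite big1// => A /andP[/andP[Ai AC] AD].
  by rewrite /atom_sign card_atoms_inU// exprS mulN1r subrr.
- by move=> A /andP[Ai _]; apply: atom_disjointVsub.
- move=> A AD; rewrite invariantU_atom//; congr (_ && _).
  by rewrite -!setI_eq0 setIUl setU_eq0 !setI_eq0 DC andbT.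
Qed.

Lemma sum_invariant_no_atom (F : {set V} -> R) : (forall D, ~~ atom D) ->
  \sum_(A | invariant_set A) atom_sign A * F A = F set0.
Proof.
move=> noat; rewrite (eq_bigl (pred1 set0)) ?big_pred1_eq ?atom_sign0 ?mul1r//.
move=> A /=; have [->|A0] := eqVneq A set0; first exact: invariant_set0.
apply/negP => Ai; have [D Dat _] := exists_atom (invariant_stable Ai A0).
by have := noat D; rewrite Dat.
Qed.

End SignedSums.
End FunctionalGraph.

(** Allows the sign of [A] to be computed inside the right-divisor attached to [A] rather than
    inside [h]. *)
Lemma atom_restrict (V : finType) (phi psi : V -> V) (S A C : {set V}) :
    A \subset S -> {in A, psi =1 phi} ->
  atom psi A C = atom phi S C && (C \subset A).
Proof.
move=> AS psiE; have st B : stable psi A B = stable phi S B && (B \subset A).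
  rewrite /stable; have [BA|] := boolP (B \subset A); last by rewrite !andbF.
  rewrite (subset_trans BA AS) andbT; congr [&& _, _ & _].
  by rewrite (@eq_in_imset _ _ phi psi)// => x /(subsetP BA)/psiE.
apply/idP/idP => [/minsetP[]|/andP[/minsetP[Cst Cmin] CA]].
  rewrite st => /andP[Cst CA] Cmin; rewrite CA andbT; apply/minsetP; split=> //.
  by move=> B Bst BC; apply: Cmin => //; rewrite st Bst (subset_trans BC CA).
apply/minsetP; rewrite st Cst CA; split=> // B.
by rewrite st => /andP[Bst _]; apply: Cmin.
Qed.

(** * Right-divisors of hikes *)

Section LastArcs.
Variables (V : finType) (E : {set V * V}).
Implicit Types (x y : trace E) (h d s : hike E) (A C : {set V}).
Local Open Scope group_scope.

(** Independent of the representative, and jointly a complete invariant of the trace, by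
    [trace_congrP]. *)
Definition arcs_from x i : seq (arc E) := [seq a <- repr x | src a == i].

Lemma arcs_from_of u i : arcs_from (trace_of u) i = [seq a <- u | src a == i].
Proof. by have /trace_ofP/trace_congrP/(_ i) := trace_ofK (trace_of u). Qed.

Lemma arcs_fromM x y i : arcs_from (x * y) i = arcs_from x i ++ arcs_from y i.
Proof.
by rewrite -[x]trace_ofK -[y]trace_ofK -trace_ofM !arcs_from_of filter_cat.
Qed.

Lemma arcs_from1 i : arcs_from 1 i = [::].
Proof. by rewrite -trace_of1 arcs_from_of. Qed.

Lemma eq_arcs_from x y : arcs_from x =1 arcs_from y -> x = y.
Proof.
move=> xy; rewrite -[x]trace_ofK -[y]trace_ofK.
by apply/trace_ofP/trace_congrP => i; apply: xy.
Qed.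

Lemma src_arcs_from x i a : a \in arcs_from x i -> src a = i.
Proof. by rewrite mem_filter => /andP[/eqP]. Qed.

Lemma trace_mulIg x : injective (fun y => y * x).
Proof.
move=> y z yz; apply: eq_arcs_from => i.
have := congr1 (arcs_from^~ i) yz; rewrite !arcs_fromM => /eqP.
(* Prefixes of equal size can be compared directly; unequal sizes contradict the total lengths. *)
have [sz|sz] := eqVneq (size (arcs_from y i)) (size (arcs_from z i)).
  by rewrite eqseq_cat// eqxx andbT => /eqP.
move=> /eqP/(congr1 size)/eqP; rewrite !size_cat eqn_add2r.
by rewrite (negbTE sz).
Qed.

Lemma arcs_from_flatten (g : V -> seq (arc E)) (r : seq V) i :
    uniq r -> (forall j a, j \in r -> a \in g j -> src a = j) ->
  arcs_from (trace_of (flatten [seq g j | j <- r])) i =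
  if i \in r then g i else [::].
Proof.
rewrite arcs_from_of; elim: r => [//|j r IH] /= /andP[jr Ur] gsrc.
rewrite filter_cat IH//; last first.
  by move=> k a kr; apply: gsrc; rewrite inE kr orbT.
have gj a : a \in g j -> src a = j by apply: gsrc; rewrite mem_head.
rewrite inE; have [->|ij] := eqVneq i j.
  rewrite (negbTE jr) cats0; apply/all_filterP/allP => a /gj ->; exact: eqxx.
rewrite (_ : filter _ (g j) = [::])//; apply/eqP.
rewrite -(negbK (_ == _)) -has_filter; apply/hasPn => a /gj ->.
by rewrite eq_sym.
Qed.

Lemma count_arcs_from (P : pred (arc E)) x :
  count P (repr x) = (\sum_j count P (arcs_from x j))%N.
Proof.
rewrite /arcs_from; elim: (repr x) => [|a u IH] /=; first by rewrite big1.
rewrite IH (bigD1 (src a))//= [in RHS](bigD1 (src a))//= eqxx/= addnA.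
congr (_ + _)%N; apply: eq_bigr => j; rewrite eq_sym => /negbTE -> //.
Qed.

Lemma balancedE x : balanced x <->
  forall i, size (arcs_from x i) =
            (\sum_j count (fun a => tgt a == i) (arcs_from x j))%N.
Proof.
split=> [/forallP xb i|xb]; last apply/forallP => i.
  by rewrite -count_arcs_from -(eqP (xb i)) size_filter.
by rewrite [X in _ == X]count_arcs_from -xb size_filter.
Qed.

Lemma balanced_mull x y : balanced (x * y) -> balanced y -> balanced x.
Proof.
move=> /balancedE xyb /balancedE yb; apply/balancedE => i.
have := xyb i; rewrite arcs_fromM size_cat yb => /eqP.
under [X in _ == X]eq_bigr do rewrite arcs_fromM count_cat.
by rewrite big_split/= eqn_add2r => /eqP.
Qed.

Definition supp x : {set V} := [set i | arcs_from x i != [::]].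

(** The map phi, made total by fixing the vertices outside the support. *)
Definition next x i : V := last i [seq tgt a | a <- arcs_from x i].

Lemma mem_supp x i a : a \in arcs_from x i -> i \in supp x.
Proof. by rewrite inE; case: (arcs_from x i). Qed.

Lemma tgt_supp x i a : balanced x -> a \in arcs_from x i -> tgt a \in supp x.
Proof.
move=> /balancedE xb ax; rewrite inE -size_eq0 xb -lt0n (bigD1 i)//=.
by rewrite addn_gt0 -has_count; apply/orP; left; apply/hasP; exists a => /=.
Qed.

Lemma supp_tgt x i : balanced x -> i \in supp x ->
  exists j a, a \in arcs_from x j /\ tgt a = i.
Proof.
move=> /balancedE xb; rewrite inE -size_eq0 xb sum_nat_eq0 => /forallPn[j].
rewrite /= -lt0n -has_count => /hasP[a ax /eqP ai].
by exists j, a.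
Qed.

Lemma last_arc x i : i \in supp x ->
  exists p a, [/\ arcs_from x i = rcons p a, src a = i & next x i = tgt a].
Proof.
rewrite inE /next; case/lastP xiE: (arcs_from x i) => [//|p a] _.
exists p, a; split=> //; last by rewrite map_rcons last_rcons.
by apply: (@src_arcs_from x); rewrite xiE mem_rcons mem_head.
Qed.

Lemma next_supp x i : balanced x -> i \in supp x -> next x i \in supp x.
Proof.
move=> xb /last_arc[p [a [xiE _ ->]]]; apply: (@tgt_supp _ i) => //.
by rewrite xiE mem_rcons mem_head.
Qed.

Lemma nextM x y i :
  next (x * y) i = if i \in supp y then next y i else next x i.
Proof.
rewrite /next arcs_fromM map_cat last_cat inE.
by case: (arcs_from y i) => [|a s] //.
Qed.

Lemma supp1 : supp 1 = finset.set0.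
Proof. by apply/setP => i; rewrite !inE arcs_from1. Qed.

Lemma supp_eq0 x : (supp x == finset.set0) = (x == 1).
Proof.
apply/eqP/eqP => [x0|->]; last exact: supp1.
apply: eq_arcs_from => i; rewrite arcs_from1; apply/eqP.
by have := in_set0 i; rewrite -x0 inE => /negbFE.
Qed.

Lemma supp_stable x : balanced x -> x != 1 -> stable (next x) (supp x) (supp x).
Proof.
move=> xb x1; rewrite /stable supp_eq0 x1 subxx/=.
by apply/subsetP => _ /imsetP[i ix ->]; apply: next_supp.
Qed.

(** * Splitting off the last arcs *)

Definition last_arcs x i : seq (arc E) :=
  drop (size (arcs_from x i)).-1 (arcs_from x i).

(** The right-divisor s_A. Each block [last_arcs x i] is a singleton on the support and empty
    elsewhere. *)
Definition final x A : trace E :=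
  trace_of (flatten [seq last_arcs x i | i <- enum A]).

Definition initial x A : trace E :=
  trace_of (flatten [seq if i \in A
    then take (size (arcs_from x i)).-1 (arcs_from x i) else arcs_from x i
  | i <- enum V]).

Lemma arcs_from_final x A i :
  arcs_from (final x A) i = if i \in A then last_arcs x i else [::].
Proof.
rewrite arcs_from_flatten ?enum_uniq ?mem_enum// => j a _ /mem_drop.
exact: src_arcs_from.
Qed.

Lemma initial_final x A : x = initial x A * final x A.
Proof.
apply: eq_arcs_from => i; rewrite arcs_fromM arcs_from_final.
rewrite arcs_from_flatten ?enum_uniq ?mem_enum//.
  by case: ifP; rewrite ?cat_take_drop ?cats0.
move=> j a _; case: ifP => _; last exact: src_arcs_from.
by move=> /mem_take; apply: src_arcs_from.
Qed.

Lemma last_arcs_supp x i : i \in supp x -> exists a,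
  [/\ last_arcs x i = [:: a], a \in arcs_from x i, src a = i
    & next x i = tgt a].
Proof.
move=> /last_arc[p [a [xiE ai xa]]]; exists a; split=> //.
  by rewrite /last_arcs xiE size_rcons/= -cats1 drop_size_cat.
by rewrite xiE mem_rcons mem_head.
Qed.

Lemma supp_final x A : A \subset supp x -> supp (final x A) = A.
Proof.
move=> Ax; apply/setP => i; rewrite inE arcs_from_final.
case: ifP => [/(subsetP Ax)/last_arcs_supp[a [-> _ _ _]]//|//].
Qed.

Lemma next_final x A i : A \subset supp x -> i \in A ->
  next (final x A) i = next x i.
Proof.
move=> Ax iA; rewrite {1}/next arcs_from_final iA.
by have [a [-> _ _ ->]] := last_arcs_supp (subsetP Ax i iA).
Qed.

Lemma final_balanced x A :
  invariant_set (next x) (supp x) A -> balanced (final x A).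
Proof.
move=> Ai; have /andP[Ax /eqP fA] := Ai; apply/balancedE => i.
rewrite arcs_from_final.
(* Both counts are the indicator of [A], because phi permutes [A]. *)
transitivity ((i \in A) : nat).
  by case: ifP => [/(subsetP Ax)/last_arcs_supp[a [-> _ _ _]]//|//].
rewrite (bigID (mem A))/= [X in (_ + X)%N]big1 ?addn0; last first.
  by move=> j /negbTE jA; rewrite arcs_from_final jA.
rewrite (eq_bigr (fun j => (next x j == i) : nat)); last first.
  move=> j jA; rewrite arcs_from_final jA.
  by have [a [-> _ _ ->]] /= := last_arcs_supp (subsetP Ax j jA); rewrite addn0.
case: (boolP (i \in A)) => [|iA].
  rewrite -{1}fA => /imsetP[k kA ->]; rewrite (bigD1 k)//= eqxx big1 ?addn0//.
  move=> j /andP[jA jk]; rewrite (inj_in_eq (invariant_inj Ai))//.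
  by rewrite (negbTE jk).
rewrite big1// => j jA; case: eqP => // ji; move: iA.
by rewrite -ji -fA imset_f.
Qed.

Lemma final_disjointU x A C : [disjoint A & C] ->
  final x (A :|: C) = final x A * final x C.
Proof.
move=> AC; apply: eq_arcs_from => i; rewrite arcs_fromM !arcs_from_final inE.
by case: (boolP (i \in A)) => // iA; rewrite (disjointFr AC iA) cats0.
Qed.

(** The default 1 is taken only for an unbalanced trace, which [final_balanced] excludes when [A] is
    invariant. *)
Definition final_hike h A : hike E := insubd (1 : hike E) (final (val h) A).

Definition initial_hike h A : hike E := insubd (1 : hike E) (initial (val h) A).

Local Notation inv h := (invariant_set (next (val h)) (supp (val h))).
Local Notation cyc h := (atom (next (val h)) (supp (val h))).

Lemma val_final_hike h A : inv h A -> val (final_hike h A) = final (val h) A.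
Proof. by move=> Ai; rewrite /final_hike insubdK//; apply: final_balanced. Qed.

Lemma initial_final_hike h A : inv h A ->
  h = initial_hike h A * final_hike h A.
Proof.
move=> Ai; apply: val_inj.
change (val h = val (initial_hike h A) * val (final_hike h A)).
have finb := final_balanced Ai.
rewrite val_final_hike// /initial_hike insubdK -?initial_final//.
by apply: balanced_mull finb; rewrite -initial_final; apply: valP.
Qed.

Lemma final_hike_disjointU h A C : inv h A -> inv h C -> [disjoint A & C] ->
  final_hike h (A :|: C) = final_hike h A * final_hike h C.
Proof.
move=> Ai Ci AC; apply: val_inj.
change (val (final_hike h (A :|: C)) =
  val (final_hike h A) * val (final_hike h C)).
by rewrite !val_final_hike ?invariantU//; apply: final_disjointU.
Qed.

Lemma final_hike_inj h A B :
  inv h A -> inv h B -> final_hike h A = final_hike h B -> A = B.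
Proof.
move=> Ai Bi /(congr1 val); rewrite !val_final_hike// => /(congr1 supp).
by rewrite !supp_final//; [case/andP: Bi|case/andP: Ai].
Qed.

Lemma final_hike0 h : final_hike h finset.set0 = 1.
Proof.
apply: val_inj; rewrite val_final_hike ?invariant_set0//.
by apply: eq_arcs_from => i; rewrite arcs_from_final inE arcs_from1.
Qed.

(** * Squarefree and prime right-divisors *)

Definition squarefree x : bool := [forall i, (size (arcs_from x i) <= 1)%N].

Lemma squarefree_arcs x i : squarefree x -> i \in supp x ->
  exists a, [/\ arcs_from x i = [:: a], src a = i & next x i = tgt a].
Proof.
move=> /forallP/(_ i) sf /last_arc[p [a [xi ai ia]]]; exists a; split=> //.
by move: sf; rewrite xi size_rcons ltnS leqn0 size_eq0 => /eqP->.
Qed.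

(** By balance each vertex of the support is the target of some arc, which is the only, hence last,
    arc at its source. *)
Lemma squarefree_invariant x : balanced x -> squarefree x ->
  invariant_set (next x) (supp x) (supp x).
Proof.
move=> xb xsf; rewrite /invariant_set subxx/= eqEsubset; apply/andP; split.
  by apply/subsetP => _ /imsetP[i ix ->]; apply: next_supp.
apply/subsetP => i /(supp_tgt xb)[j [a [aj <-]]].
have [b [jb _ nb]] := squarefree_arcs xsf (mem_supp aj).
move: (aj); rewrite jb inE => /eqP ->; rewrite -nb imset_f//.
exact: mem_supp aj.
Qed.

Lemma final_squarefree x A : A \subset supp x -> squarefree (final x A).
Proof.
move=> Ax; apply/forallP => i; rewrite arcs_from_final; case: ifP => // iA.
by have [a [-> _ _ _]] := last_arcs_supp (subsetP Ax i iA).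
Qed.

Lemma invariant_eq_next x y A : {in A, next x =1 next y} -> A \subset supp x ->
  invariant_set (next y) (supp y) A -> invariant_set (next x) (supp x) A.
Proof.
move=> xy Ax /andP[_ /eqP fA]; rewrite /invariant_set Ax/=; apply/eqP.
by rewrite -{2}fA; apply: eq_in_imset.
Qed.

Lemma suppM x y : supp (x * y) = supp x :|: supp y.
Proof.
by apply/setP => i; rewrite !inE arcs_fromM; case: (arcs_from x i).
Qed.

(** In a product the arcs of the right factor come last at each vertex, so a single arc there is the
    last arc of [h]. *)
Lemma squarefree_right_divisor h d s : h = d * s -> squarefree (val s) ->
  inv h (supp (val s)) /\ s = final_hike h (supp (val s)).
Proof.
move=> hE ssf; have vhE : val h = val d * val s by rewrite hE.
have sh : supp (val s) \subset supp (val h) by rewrite vhE suppM subsetUr.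
have Ai : inv h (supp (val s)).
  apply: (@invariant_eq_next _ (val s)) => //.
  - by move=> i si; rewrite vhE nextM si.
  - by apply: squarefree_invariant => //; apply: valP.
split=> //; apply: val_inj; rewrite val_final_hike//.
apply: eq_arcs_from => i; rewrite arcs_from_final.
case: ifP => [si|]; last by rewrite inE => /negbFE/eqP.
have [a [sa _ _]] := squarefree_arcs ssf si.
rewrite /last_arcs vhE arcs_fromM sa size_cat/= addn1/=.
by rewrite drop_size_cat.
Qed.

Lemma prime_squarefree c : is_prime c -> squarefree (val c).
Proof.
move=> [w <- [_ _ wU]]; apply/forallP => i; rewrite arcs_from_of size_filter.
by have := count_uniq_mem i wU; rewrite count_map => ->; case: (i \in _).
Qed.

Lemma prime_right_divisor_atom h c : prime_right_divisor h c ->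
  exists2 C, cyc h C & c = final_hike h C.
Proof.
move=> [cp [d hE]]; have csf := prime_squarefree cp.
have [Ci cE] := squarefree_right_divisor hE csf; exists (supp (val c)) => //.
have vhE : val h = val d * val c by rewrite hE.
have nexth i : i \in supp (val c) -> next (val h) i = next (val c) i.
  by move=> ci; rewrite vhE nextM ci.
have [w wc [w0 wcyc wU]] := cp.
have wsrc a : a \in w -> a \in arcs_from (val c) (src a).
  by move=> aw; rewrite -wc arcs_from_of mem_filter eqxx.
have suppc i : i \in supp (val c) -> i \in [seq src a | a <- w].
  move=> /last_arcs_supp[a [_ + <- _]].
  by rewrite -wc arcs_from_of mem_filter => /andP[_ aw]; apply: map_f.
have wnext a : a \in w -> next (val h) (src a) = tgt a.
  move=> aw; have cs := mem_supp (wsrc a aw); rewrite nexth//.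
  have [b [cb _ ->]] := squarefree_arcs csf cs.
  by have := wsrc a aw; rewrite cb inE => /eqP ->.
have fcyc : fcycle (next (val h)) ([seq src a | a <- w]).
  rewrite cycle_map; apply: (sub_in_cycle (P := mem w)) wcyc; last exact/allP.
  by move=> a b aw _ ab; rewrite /= wnext.
have c0 : supp (val c) != finset.set0.
  case: w w0 wsrc {wc wcyc wU suppc wnext fcyc} => // a w _ wsrc.
  apply/set0Pn; exists (src a); apply: (@mem_supp _ _ a); apply: wsrc.
  exact: mem_head.
apply/minsetP; split=> [|B /and3P[/set0Pn[i iB] _ /subsetP fB] Bc].
  exact: invariant_stable.
(* Iterating phi from a vertex of [B] runs through the whole cycle. *)
apply/eqP; rewrite eqEsubset Bc; apply/subsetP => j /suppc jw.
have iw := suppc i (subsetP Bc i iB).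
move: jw; rewrite -(fconnect_cycle fcyc iw) => /iter_findex <-.
by elim: findex => [//|n IH]; apply/fB/imset_f.
Qed.

(** The orbit of a vertex of [C] is stable, so it is all of [C]; the last arcs along it spell a
    simple cycle. *)
Lemma atom_final_prime h C : cyc h C -> is_prime (final_hike h C).
Proof.
move=> Cat; have Ci := atom_invariant Cat.
have /and3P[C0 Ch fC] := atom_stable Cat.
have fC' : {homo next (val h) : i / i \in C}.
  by move=> i iC; apply: (subsetP fC); apply: imset_f.
have [i iC] := set0Pn _ C0.
have [a0 _] := last_arcs_supp (subsetP Ch i iC).
pose g j := last a0 (arcs_from (val h) j).
have gP j : j \in C ->
    [/\ last_arcs (val h) j = [:: g j], src (g j) = j
      & tgt (g j) = next (val h) j].
  move=> /(subsetP Ch)/last_arc[p [a [hj aj nj]]].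
  rewrite /last_arcs /g hj last_rcons size_rcons/= -cats1 drop_size_cat//.
set p := fingraph.orbit (next (val h)) i.
have pC j : j \in p -> j \in C.
  rewrite -fconnect_orbit => /iter_findex <-.
  by elim: findex => //= n; apply: fC'.
have pcyc : fcycle (next (val h)) p.
  exact: (@cycle_orbit_in _ _ (mem C) fC' (invariant_inj Ci)).
have CE : [set j in p] = C.
  apply: (minsetinf Cat); last by apply/subsetP => j; rewrite inE; apply: pC.
  apply/and3P; split.
  - by apply/set0Pn; exists i; rewrite inE in_orbit.
  - by apply/subsetP => j; rewrite inE => /pC/(subsetP Ch).
  - apply/subsetP => _ /imsetP[j jp ->].
    rewrite !inE in jp *; exact: mem_fcycle pcyc _ jp.
exists (map g p).
  rewrite /represents val_final_hike//; apply: eq_arcs_from => j.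
  rewrite -[map g p]flatten_seq1 -map_comp.
  rewrite arcs_from_flatten ?orbit_uniq//; last first.
    by move=> k a /pC/gP[_ gk _]; rewrite inE => /eqP ->.
  rewrite arcs_from_final -CE inE; case: ifP => // /pC/gP[-> _ _] //.
split.
- by rewrite -size_eq0 size_map size_orbit -orderSpred.
- rewrite cycle_map; apply: (sub_in_cycle (P := mem p)) pcyc; last exact/allP.
  move=> j k /pC/gP[_ _ jg] /pC/gP[_ kg _] /eqP jk.
  by rewrite /= /consecutive jg kg jk.
- rewrite -map_comp (_ : map _ p = p) ?orbit_uniq//.
  by apply: map_id_in => j /pC/gP[].
Qed.

Lemma atom_prime_right_divisor h C :
  cyc h C -> prime_right_divisor h (final_hike h C).
Proof.
move=> Cat; split; first exact: atom_final_prime.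
by exists (initial_hike h C); apply/initial_final_hike/atom_invariant.
Qed.

(** * Walks and the number of cycles *)

Lemma no_atom1 C : ~~ cyc (1 : hike E) C.
Proof.
by apply/negP => /atom_stable/and3P[C0]; rewrite supp1 subset0 (negbTE C0).
Qed.

Lemma exists_hike_atom h : h <> 1 -> exists C, cyc h C.
Proof.
move=> h1; have hst : stable (next (val h)) (supp (val h)) (supp (val h)).
  by apply: supp_stable; [apply: valP|apply/eqP => h1'; apply/h1/val_inj].
by have [C Cat _] := exists_atom hst; exists C.
Qed.

(* In a contiguous word the arc following the last exit from a stable set     *)
(* would again start in that set.                                             *)
Lemma walk_last_stable h w a C : represents (rcons w a) h ->
    sorted (@consecutive V E) (rcons w a) ->
  stable (next (val h)) (supp (val h)) C -> src a \in C.
Proof.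
move=> wh ws /and3P[/set0Pn[i iC] /subsetP Ch /subsetP fC].
have hasC : has (fun b => src b \in C) (rev (rcons w a)).
  have [b [_ bh bi _]] := last_arcs_supp (Ch i iC).
  apply/hasP; exists b; last by rewrite bi.
  by rewrite mem_rev; move: bh; rewrite -wh arcs_from_of mem_filter => /andP[].
have wE : rcons w a = rev (rev (rcons w a)) by rewrite revK.
case: (split_find hasC) wE => b p s bC pC wE.
rewrite rev_cat rev_rcons in wE; have {}pC c : c \in rev p -> src c \notin C.
  by rewrite mem_rev => /(hasPn pC).
case: (rev p) => [|c q] in wE pC.
  by have [_ ->] := rcons_inj (etrans wE (cats1 _ _)).
move: ws; rewrite wE => /cat_sorted2[_ /andP[/eqP bc _]].
have := pC c (mem_head c q); rewrite -bc; case/negP.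
suff <- : next (val h) (src b) = tgt b by apply/fC/imset_f.
rewrite /next -wh wE arcs_from_of -cat_rcons filter_cat filter_rcons eqxx.
rewrite (_ : filter _ (c :: q) = [::]) ?cats0 ?map_rcons ?last_rcons//.
apply/eqP; rewrite -[_ == _]negbK -has_filter; apply/hasPn => d /pC dC.
by apply: contraNneq dC => ->.
Qed.

Lemma walk_unique_atom h C D : is_walk h -> cyc h C -> cyc h D -> C = D.
Proof.
move=> [w wh ws] Cat Dat; case/lastP: w wh ws => [|w a] wh ws.
  have [/set0Pn[i iC] /subsetP/(_ i iC)+ _] := and3P (atom_stable Cat).
  by rewrite inE -wh arcs_from_of.
apply/eqP; apply: contraT => /(atom_disjoint Cat Dat) CD.
have aC := walk_last_stable wh ws (atom_stable Cat).
have aD := walk_last_stable wh ws (atom_stable Dat).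
by rewrite (disjointFr CD aC) in aD.
Qed.

(* Follow the first unused arc out of the current vertex j until it has none  *)
(* left: by the balance hypothesis this only happens back at i.               *)
Lemma greedy_walk (u : seq (arc E)) (i j : V) :
    (forall k, count (fun a => src a == k) u + (k == i) =
               count (fun a => tgt a == k) u + (k == j))%N ->
  exists w r, [/\ trace_congr u (w ++ r), sorted (@consecutive V E) w,
    (forall b, tgt b = j -> path (@consecutive V E) b w),
    (forall a, a \in r -> src a != i) & balanced_word r].
Proof.
have [n] := ubnP (size u); elim: n => // n IH in u j * => usz ub.
have [hasj|/hasPn nj] := boolP (has (fun a => src a == j) u); last first.
  have u0 : count (fun a => src a == j) u = 0.
    by apply/eqP; rewrite -leqn0 leqNgt -has_count; apply/hasPn.
  (* With no arc leaving [j], the hypothesis at [j] forces [j = i]. *)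
  have := ub j; rewrite u0 eqxx; case: eqP => [ji _|]; last by rewrite addn1.
  exists [::], u; split=> //; first exact: trace_congr_refl.
    by move=> a au; rewrite -ji nj.
  by apply/forallP => k; have := ub k; rewrite -ji => /addIn ->.
case: (split_find hasj) usz ub => a p s /eqP aj pj usz ub.
have [||w [r [uwr ws wp ri rb]]] := IH (p ++ s) (tgt a).
- by move: usz; rewrite !size_cat size_rcons addSn.
- move=> k; have := ub k; rewrite -!cats1 !count_cat/= aj => E1.
  move: E1; rewrite !addn0 (eq_sym j) (eq_sym (tgt a)).
  by move: (k == j) (k == i) (k == tgt a) => [] [] [] /=; lia.
exists (a :: w), r; split=> //.
(* No arc of [p] starts at the source of [a], so [a] commutes to the front. *)
- apply: trace_congr_trans (trace_congr_cat (trace_congr_refl [:: a]) uwr).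
  apply/trace_congrP => k; rewrite -cats1 /= !filter_cat/=.
  case: eqP => [ak|_]; last by rewrite cats0.
  rewrite (_ : filter _ p = [::])//.
  apply/eqP; rewrite -[_ == _]negbK -has_filter.
  by move: pj; rewrite -aj ak.
- by rewrite /= wp.
- by move=> b bj; rewrite /= wp// /consecutive bj aj eqxx.
Qed.

Lemma unique_atom_walk h C :
  cyc h C -> (forall D, cyc h D -> D = C) -> is_walk h.
Proof.
move=> Cat uC; have [i iC] := set0Pn _ (atom_neq0 Cat).
have hb : balanced_word (repr (val h)) by exact: (valP h).
have [k|w [r [hwr ws _ ri rb]]] := @greedy_walk (repr (val h)) i i.
  by rewrite (eqP (forallP hb k)).
have hE : val h = trace_of w * trace_of r.
  by rewrite -trace_ofM -[LHS]trace_ofK; apply/trace_ofP.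
exists w => //; have [r1|/eqP r1] := eqVneq (trace_of r) 1.
  by rewrite /represents hE r1 mulg1.
have := supp_stable (x := trace_of r); rewrite balanced_of rb.
move=> /(_ isT (introN eqP r1)) rst.
have rh : supp (trace_of r) \subset supp (val h) by rewrite hE suppM subsetUr.
(* As a right factor, the leftover [r] has the same last arcs as [h] on its support, so it would
   contain an atom of [h]. *)
have /exists_atom[D Dat] :
    stable (next (val h)) (supp (val h)) (supp (trace_of r)).
  have /and3P[r0 _ fr] := rst; rewrite /stable r0 rh/=; apply: subset_trans fr.
  by apply/subsetP => _ /imsetP[k kr ->]; rewrite hE nextM kr imset_f.
rewrite (uC D Dat) => /subsetP/(_ i iC)/last_arcs_supp[a [_ ar ai _]].
by move: ar; rewrite arcs_from_of mem_filter => /andP[_ /ri]; rewrite ai eqxx.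
Qed.

End LastArcs.

(** * Dirichlet convolution *)

From mathcomp Require Import all_classical all_reals.

Section DirichletConvolution.
Variables (V : finType) (E : {set V * V}) (R : realType).
Implicit Types (h d s e b : hike E) (f g k : hike E -> R).
Local Open Scope classical_set_scope.
Local Open Scope ring_scope.
Local Open Scope group_scope.

Lemma hike_mulgI d s s' : d * s = d * s' -> s = s'.
Proof.
by move=> /(congr1 val) ds; apply/val_inj/(@trace_mulgI _ _ (val d)).
Qed.

Lemma hike_mulIg d d' s : d * s = d' * s -> d = d'.
Proof.
by move=> /(congr1 val) ds; apply/val_inj/(@trace_mulIg _ _ (val s)).
Qed.

Lemma hdvd1 h : hdvd 1 h.
Proof. by exists h; rewrite mul1g. Qed.

Lemma hdvdd h : hdvd h h.
Proof. by exists 1; rewrite mulg1. Qed.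

Lemma mul_hdivK d h : hdvd d h -> h = d * hdiv h d.
Proof. by move=> [s hE]; rewrite (hdivE hE). Qed.

Lemma hdivh1 h : hdiv h 1 = h.
Proof. by apply: hdivE; rewrite mul1g. Qed.

Lemma hdiv_eq1 d h : hdvd d h -> hdiv h d = 1 -> d = h.
Proof. by move=> /mul_hdivK {2}-> ->; rewrite mulg1. Qed.

Definition hike_length h : nat := size (repr (val h)).

Lemma hike_lengthM d s :
  hike_length (d * s) = (hike_length d + hike_length s)%N.
Proof.
rewrite /hike_length -size_cat; apply/perm_size/trace_congr_perm/trace_ofP.
by rewrite trace_ofM !trace_ofK.
Qed.

Lemma hike_length_gt0 h : h != 1 -> (0 < hike_length h)%N.
Proof.
rewrite lt0n; apply: contra_neq => /size0nil h0; apply: val_inj.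
by rewrite -[LHS]trace_ofK h0.
Qed.

Lemma dconvA f g k : dconv (dconv f g) k = dconv f (dconv g k).
Proof.
apply/funext => h; pose D x := [set d : hike E | hdvd d x].
pose T e d : R := (f e * g (hdiv d e) * k (hdiv h d))%R.
(* Both sides sum [T] over chains e | d | h; the inner sum is then reindexed by d = e * b. *)
transitivity (\sum_(e \in D h) \sum_(d \in D h `&` [set d | hdvd e d]) T e d)%R.
  transitivity (\sum_(d \in D h) \sum_(e \in D h `&` D d) T e d)%R.
    apply: eq_fsbigr => d; rewrite inE => dh.
    rewrite (_ : D h `&` D d = D d) ?mulr_fsuml//.
    apply/seteqP; split=> [e []//|e [s ds]]; split; last by exists s.
    by exists (s * hdiv h d); rewrite mulgA -ds -mul_hdivK.
  under eq_fsbigr do rewrite fsbig_mkcondr.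
  under [RHS]eq_fsbigr do rewrite fsbig_mkcondr.
  rewrite exchange_fsbig; [|exact: finite_hdvd|exact: finite_hdvd].
  by apply: eq_fsbigr => e _; apply: eq_fsbigr => d _.
apply: eq_fsbigr => e; rewrite inE => eh.
rewrite (@reindex_fsbig _ _ _ _ _ (fun b => e * b) (D (hdiv h e))).
  rewrite /dconv mulr_fsumr; apply: eq_fsbigr => b; rewrite inE => be.
  rewrite /T (@hdivE _ _ e (e * b) b)// -mulrA; congr (_ * (_ * k _))%R.
  by apply: hdivE; rewrite -mulgA -mul_hdivK// -mul_hdivK.
split.
- move=> b /= be; split; last by exists b.
  by exists (hdiv (hdiv h e) b); rewrite -mulgA -mul_hdivK// -mul_hdivK.
- by move=> b b' _ _; apply: hike_mulgI.
- move=> d [[s dh] [b db]]; exists b => //.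
  by exists s; apply: hdivE; rewrite mulgA -db.
Qed.

Lemma dconv_delta f : dconv (@ddelta V E R) f = f.
Proof.
apply/funext => h; rewrite /dconv (@fsbigD1 _ _ _ _ 1)//=; last exact: hdvd1.
  rewrite /ddelta eqxx mul1r hdivh1 fsbig1 ?addr0// => d [_ /= /eqP/negbTE ->].
  by rewrite mul0r.
exact: finite_hdvd.
Qed.

Lemma dconv1_delta : dconv (fun=> 1%R) (@ddelta V E R) = fun=> 1%R.
Proof.
apply/funext => h; rewrite /dconv (@fsbigD1 _ _ _ _ h)//=; last exact: hdvdd.
  rewrite (@hdivE _ _ h h 1) ?mulg1// /ddelta eqxx mulr1 fsbig1 ?addr0//.
  move=> d [dh /= hd]; rewrite (_ : hdiv h d == 1 = false) ?mulr0//.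
  by apply/eqP => /(hdiv_eq1 dh).
exact: finite_hdvd.
Qed.

(** The divisor 1 contributes the value at [h], all others values at strictly shorter hikes:
    induction on length. *)
Lemma dconv1_inj f g : dconv (fun=> 1%R) f = dconv (fun=> 1%R) g -> f = g.
Proof.
move=> fg; apply/funext => h; have [n] := ubnP (hike_length h).
elim: n => // n IH in h * => hn.
have := congr1 (@^~ h) fg; rewrite /dconv.
have fin := finite_hdvd h.
rewrite !(@fsbigD1 _ _ _ _ (1 : hike E) _ _ fin (hdvd1 h))/= !hdivh1 !mul1r.
rewrite (_ : \sum_(_ \in _) _ =
  \sum_(j \in [set d | hdvd d h] `\ (1%g : hike E)) 1 * g (hdiv h j))%R.
  exact: addIr.
apply: eq_fsbigr => d; rewrite inE => -[dh /eqP d1].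
rewrite IH//; move: hn; rewrite {1}(mul_hdivK dh) hike_lengthM ltnS.
by apply: leq_trans; rewrite -[X in (X < _)%N]add0n ltn_add2r hike_length_gt0.
Qed.

(* A squarefree hike leaves each vertex at most once, so it is a product of   *)
(* vertex-disjoint simple cycles, which are its atoms.                        *)
Definition cycle_mobius s : R :=
  if squarefree (val s)
  then atom_sign (next (val s)) (supp (val s)) R (supp (val s)) else 0%R.

Local Notation inv h := (invariant_set (next (val h)) (supp (val h))).
Local Notation cyc h := (atom (next (val h)) (supp (val h))).
Local Notation sgn h := (atom_sign (next (val h)) (supp (val h)) R).

Lemma cycle_mobius_final h A :
  inv h A -> cycle_mobius (final_hike h A) = sgn h A.
Proof.
move=> Ai; have /andP[Ah _] := Ai; rewrite /cycle_mobius val_final_hike//.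
rewrite final_squarefree// supp_final// /atom_sign.
congr (_ ^+ #|pred_of_set _|)%R.
apply/setP => C; rewrite !finset.inE.
rewrite (@atom_restrict _ (next (val h)) _ (supp (val h)))//.
  by rewrite -andbA andbb.
by move=> i iA; apply: next_final.
Qed.

Lemma dconv_cycle_mobius f h :
  dconv f cycle_mobius h =
  (\sum_(A | inv h A) sgn h A * f (initial_hike h A))%R.
Proof.
rewrite (bigfs _ (P := fun A => inv h A)) ?index_enum_uniq//; last first.
  by move=> A _; rewrite mem_index_enum.
have hE A (Ai : inv h A) := initial_final_hike Ai.
rewrite /dconv.
(* Divisors outside this image have a quotient that is not squarefree, so they contribute 0. *)
rewrite -(@fsbig_widen _ _ _ _ (initial_hike h @` [set` fun A => inv h A])).
- rewrite fsbig_image.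
    apply: eq_fsbigr => A; rewrite inE/= => Ai.
    by rewrite (hdivE (hE A Ai)) cycle_mobius_final// mulrC.
  move=> A B; rewrite !inE /= => Ai Bi AB; apply: (final_hike_inj Ai Bi).
  by apply: (@hike_mulgI (initial_hike h A)); rewrite -hE// AB -hE.
- by move=> _ [A Ai <-]; exists (final_hike h A); apply: hE.
- move=> d [dh /= dA]; rewrite /cycle_mobius.
  case: ifP => [sf|]; last by rewrite mulr0.
  have [Ai sE] := squarefree_right_divisor (mul_hdivK dh) sf.
  case: dA; exists (supp (val (hdiv h d))) => //.
  apply: (@hike_mulIg _ _ (hdiv h d)); rewrite {2}sE -hE//.
  exact: mul_hdivK.
Qed.

Lemma cycle_mobiusE : @mobius V E R = cycle_mobius.
Proof.
have m1 : dconv (fun=> 1%R) cycle_mobius = @ddelta V E R.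
  apply/funext => h; rewrite dconv_cycle_mobius /ddelta.
  have [->|/eqP h1] := eqVneq h 1.
    rewrite (@sum_invariant_no_atom _ _ _ _ (fun=> 1%R))//; exact: no_atom1.
  have [C Cat] := exists_hike_atom h1.
  rewrite (@sum_invariant_atom _ _ _ _ C (fun=> 1%R) 0%R) ?mul0r// => A _ _.
  by rewrite subrr.
(* Cancel 1 on the left in 1 * (mu * 1) = (1 * mu) * 1 = 1 = 1 * delta. *)
have m2 : dconv cycle_mobius (fun=> 1%R) = @ddelta V E R.
  by apply: dconv1_inj; rewrite -dconvA m1 dconv_delta dconv1_delta.
rewrite /mobius; case: xgetP => [m _ [_ /= mE]|/(_ cycle_mobius)[]//].
by apply: dconv1_inj; rewrite mE m1.
Qed.

Lemma additive_initial f h A : totally_additive f -> inv h A ->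
  f (initial_hike h A) = (f h - f (final_hike h A))%R.
Proof. by move=> fM /initial_final_hike {2}->; rewrite fM addrK. Qed.

Lemma additive_initialU f h A C : totally_additive f ->
    inv h A -> cyc h C -> [disjoint A & C]%B ->
  (f (initial_hike h A) - f (initial_hike h (A :|: C)) = f (final_hike h C))%R.
Proof.
move=> fM Ai Cat AC; have Ci := atom_invariant Cat.
rewrite !additive_initial ?invariantU// final_hike_disjointU// fM.
by rewrite opprB !addrA subrK addrAC subrr add0r.
Qed.

End DirichletConvolution.

Theorem proposition3p5 (R : realType) (V : finType) (E : {set V * V})
    (f : hike E -> R) (hf : totally_additive f) (h : hike E) :
  (h <> 1%g -> is_walk h ->
     exists2 c : hike E, unique (prime_right_divisor h) c &
       dconv f (@mobius V E R) h = f c) /\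
  (~ (h <> 1%g /\ is_walk h) -> dconv f (@mobius V E R) h = 0%R).
Proof.
rewrite cycle_mobiusE dconv_cycle_mobius; split=> [h1 hw|hnw].
  have [C Cat] := exists_hike_atom h1; exists (final_hike h C).
    split=> [|c /prime_right_divisor_atom[D Dat ->]].
      exact: atom_prime_right_divisor.
    by rewrite (walk_unique_atom hw Cat Dat).
  rewrite (@sum_invariant_atom _ _ _ _ C _ (f (final_hike h C))) => //.
    (* With [C] the only atom, the empty set alone remains. *)
    rewrite (eq_bigl (pred1 finset.set0)) ?big_pred1_eq ?atom_sign0 ?mulr1//.
    move=> A.
    apply: invariant_disjoint_atom => // D Dat; exact: walk_unique_atom Dat Cat.
  by move=> A Ai AC; apply: additive_initialU.
have [->|/eqP h1] := eqVneq h 1%g.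
  rewrite sum_invariant_no_atom; last exact: no_atom1.
  by rewrite additive_initial ?invariant_set0// final_hike0 subrr.
have [C Cat] := exists_hike_atom h1.
(* A unique atom would make [h] a non-trivial walk. *)
have [D Dat CD] : exists2 D, atom (next (val h)) (supp (val h)) D & C != D.
  apply: contrapT => nD; apply: hnw; split=> //.
  apply: (unique_atom_walk Cat) => D Dat; apply/eqP.
  apply: contrapT => /negP DC.
  by apply: nD; exists D; rewrite // eq_sym.
rewrite (@sum_invariant_atom _ _ _ _ C _ (f (final_hike h C)))//.
  by rewrite (sum_invariant_disjoint _ Cat Dat CD) mulr0.
by move=> A Ai AC; apply: additive_initialU.
Qed.
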